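(* Let $X$ and $Y$ be finite nonempty sets and $F: X\to 2^Y$ a set-valued mapping. The following are equivalent: (i) $F$ admits a unique alldifferent selection; (ii) $F^*(x)$ is a singleton for each $x\in X$; (iii) $F$ admits a Hall partition and $F^p(x)$ is a singleton for each $x \in X$; (iv) $F$ admits a Hall partition $(W_1,\ldots,W_m)$ with $m = \sharp F(X)$.
   Context: A set-valued mapping $F: X \to 2^Y$ assigns to each $x$ a (possibly empty) subset $F(x) \subset Y$; $F(W) = \bigcup_{x\in W}F(x)$; $\sharp$ is cardinality. A selection of $F$ is $s: X\to Y$ with $s(x)\in F(x)$ for all $x$; alldifferent means injective. The alldifferent kernel is $F^*(x) = \{y\in F(x): \exists$ alldifferent selection $s$ of $F$ with $s(x)=y\}$. For $W \subset X$, $F_W: X\setminus W \to 2^Y$ is $F_W(x) = F(x) \setminus F(W)$. For set-valued $G$ on a finite set, a subset $W$ of its domain is critical for $G$ if $W\ne\emptyset$ and $\sharp G(W)=\sharp W$; non-reducible for $G$ if $W\ne\emptyset$ and no proper subset of $W$ is critical for $G$. A tuple $(W_1,\ldots,W_m)$, $m\ge1$, is a Hall partition of $F$ if the $W_i$ are nonempty, pairwise disjoint with union $X$, and with $G_i = F_{W_1\cup\cdots\cup W_{i-1}}$ ($G_1=F$): (i) $G_i(x)\neq\emptyset$ for $x \in W_i$; (ii) $W_i$ is non-reducible for $G_i$; (iii) $W_i$ is critical for $G_i$ for $i \le m-1$. Given a Hall partition, $F^p(x) = G_i(x)$ for $x\in W_i$ (this is independent of the choice of Hall partition). *)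

(* Defs.v *)
From mathcomp Require Import all_boot.

Set Implicit Arguments.
Unset Strict Implicit.
Unset Printing Implicit Defensive.

Section SetValuedMappings.

Variables X Y : finType.

Implicit Types (F G : X -> {set Y}) (W U : {set X}) (A : {set Y}).

Definition img F W : {set Y} := \bigcup_(x in W) F x.

Definition selection F (s : {ffun X -> Y}) : bool := [forall x, s x \in F x].

Definition alldiff_selection F (s : {ffun X -> Y}) : bool :=
  selection F s && injectiveb s.

Definition alldiff_kernel F (x : X) : {set Y} :=
  [set y in F x | [exists s : {ffun X -> Y}, alldiff_selection F s && (s x == y)]].

(* F_W is a mapping on X \ W; it is represented here by a total function, which
   is empty-valued on W.  The predicates below take the subset of X they bear
   on as an argument, and a Hall partition only uses them inside X \ W. *)
Definition residual F W (x : X) : {set Y} := F x :\: img F W.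

Definition critical G W : bool := (W != set0) && (#|img G W| == #|W|).

Definition non_reducible G W : bool :=
  (W != set0) && [forall U : {set X}, (U \proper W) ==> ~~ critical G U].

Section Tuples.

Variable m : nat.

Implicit Type Ws : m.-tuple {set X}.

(* Blocks are numbered from 0: [stage F Ws i] is F_{W_0 ∪ ... ∪ W_{i-1}}. *)
Definition stage F Ws (i : 'I_m) : X -> {set Y} :=
  residual F (\bigcup_(j < m | j < i) tnth Ws j).

Record hall_partition F Ws : Prop := HallPartition {
  hall_pos : 0 < m;
  hall_nonempty : forall i, tnth Ws i != set0;
  hall_disjoint : forall i j, i != j -> [disjoint tnth Ws i & tnth Ws j];
  hall_cover : \bigcup_(i < m) tnth Ws i = [set: X];
  hall_values : forall i x, x \in tnth Ws i -> stage F Ws i x != set0;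
  hall_non_reducible : forall i, non_reducible (stage F Ws i) (tnth Ws i);
  hall_critical : forall i : 'I_m, i.+1 < m -> critical (stage F Ws i) (tnth Ws i)
}.

(* When the blocks partition X, exactly one index i contributes to the union,
   so that this is [stage F Ws i x] for the block [tnth Ws i] containing x. *)
Definition hall_mapping F Ws (x : X) : {set Y} :=
  \bigcup_(i < m | x \in tnth Ws i) stage F Ws i x.

End Tuples.

Definition is_singleton A : Prop := exists y, A = [set y].

End SetValuedMappings.

(* Main.v *)
Require Import Defs.
From mathcomp Require Import all_boot.

(** A unique alldifferent selection amounts to an enumeration of X along which
    F is triangular: each value F x lies in s(earlier points) + s x.  If s is
    unique, then F(X) = s(X), for otherwise a single value could be changed;
    and if no point could follow the points W already enumerated, every x
    outside W would have some f x <> x outside W with s (f x) in F x, and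
    composing s with f on a minimal nonempty f-stable set, where f is a
    permutation, would give a second selection.  The singletons of the
    enumeration form the Hall partition.  Conversely, F(X) is the disjoint union
    of the layers G_i(W_i), which are nonempty and satisfy #W_i <= #G_i(W_i), so
    m = #F(X) forces both W_i and G_i(W_i) to be singletons, and triangularity
    determines the selection block by block. *)

Set Implicit Arguments.
Unset Strict Implicit.
Unset Printing Implicit Defensive.

(** * Images of sets and Hall's condition *)

Section Images.

Variables X Y : finType.
Implicit Types (F G : X -> {set Y}) (W U : {set X}) (s : {ffun X -> Y}).

Lemma imgP F W y : reflect (exists2 x, x \in W & y \in F x) (y \in img F W).
Proof. exact: bigcupP. Qed.

Lemma imgS F U W : U \subset W -> img F U \subset img F W.
Proof.
move=> /subsetP sUW; apply/subsetP=> y /imgP[x xU yFx].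
by apply/imgP; exists x; first exact: sUW.
Qed.

Lemma img1 F x : img F [set x] = F x.
Proof. exact: big_set1. Qed.

Lemma alldiff_selectionP F s :
  reflect ((forall x, s x \in F x) /\ injective s) (alldiff_selection F s).
Proof.
apply: (iffP andP) => -[]; first by move=> /forallP ? /injectiveP.
by move=> ? ?; split; [apply/forallP | apply/injectiveP].
Qed.

(* A minimal violation of Hall's condition becomes critical once a point is
   removed. *)
Lemma non_reducible_hall G W U :
    non_reducible G W -> (forall x, x \in W -> G x != set0) ->
  U \subset W -> #|U| <= #|img G U|.
Proof.
move=> /andP[_ /forallP irrW] G_neq0.
have [n] := ubnP #|U|; elim: n U => // n IHn U ltUn sUW.
have [->|[x xU]] := set_0Vmem U; first by rewrite cards0.
have cardU : #|U| = #|U :\ x|.+1 by rewrite (cardsD1 x) xU.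
rewrite leqNgt; apply/negP=> ltGU.
have sU'U : U :\ x \subset U := subsetDl _ _.
have leU' : #|U :\ x| <= #|img G (U :\ x)|.
  by apply: IHn; [rewrite -cardU | exact: subset_trans sUW].
have leG : #|img G (U :\ x)| <= #|U :\ x|.
  rewrite -ltnS -cardU; apply: leq_ltn_trans ltGU.
  exact/subset_leq_card/imgS.
have/negP[] := implyP (irrW (U :\ x)) (proper_sub_trans (properD1 xU) sUW).
rewrite /critical eqn_leq leG leU' !andbT -card_gt0.
(* It remains to see that [U :\ x] is nonempty; otherwise [img G U] would be empty, although it
   contains the nonempty set [G x]. *)
apply: leq_trans leG; rewrite lt0n; apply/negP=> /eqP U'0.
have GU0 : img G U = set0.
  apply/cards0_eq/eqP; rewrite -leqn0 -ltnS (leq_trans ltGU) // cardU ltnS.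
  by rewrite (leq_trans leU') // U'0.
have /set0Pn[y yGx] := G_neq0 x (subsetP sUW x xU).
suff: y \in img G U by rewrite GU0 inE.
by apply/imgP; exists x.
Qed.

End Images.

(** * Layers of a Hall partition *)

Section HallPartitions.

Variables (X Y : finType) (F : X -> {set Y}) (m : nat) (Ws : m.-tuple {set X}).

(** The values that occur in block [i] and in no earlier block; for a Hall partition these sets
    split [img F [set: X]]. *)
Definition layer (i : 'I_m) : {set Y} := img (stage F Ws i) (tnth Ws i).

Lemma mem_stageP (i : 'I_m) x y :
  reflect (y \in F x /\
           forall (j : 'I_m) x', j < i -> x' \in tnth Ws j -> y \notin F x')
          (y \in stage F Ws i x).
Proof.
rewrite inE andbC; apply: (iffP andP) => -[yFx].
  move=> yN; split=> // j x' ltji x'j; apply: contra yN => yFx'.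
  by apply/imgP; exists x' => //; apply/bigcupP; exists j.
move=> yN; split=> //; apply/imgP=> -[x' /bigcupP[j ltji x'j]].
by apply/negP/(yN j).
Qed.

(** Take for [j] the least block whose image contains [y]; block [i] is a candidate, hence
    [j <= i]. *)
Lemma layer_of (i : 'I_m) x y : x \in tnth Ws i -> y \in F x ->
  exists2 j : 'I_m, j <= i & y \in layer j.
Proof.
move=> xi yFx; have Pi : y \in img F (tnth Ws i) by apply/imgP; exists x.
case: (@arg_minnP _ i (fun j => y \in img F (tnth Ws j)) val Pi) => j.
move=> /imgP[x' x'j yFx'] minj.
exists j; first exact: minj.
apply/imgP; exists x' => //; apply/mem_stageP; split=> // k z ltkj zk.
apply: contraTN ltkj => yFz; rewrite -leqNgt; apply: minj.
by apply/imgP; exists z.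
Qed.

Lemma layer_disjoint i j : i != j -> [disjoint layer i & layer j].
Proof.
wlog ltij : i j / i < j => [hw neij|_].
  have := neij; rewrite -val_eqE neq_ltn => /orP[]; first by move=> /hw->.
  by move=> /hw; rewrite disjoint_sym eq_sym; apply.
apply/pred0P=> y; apply/andP => -[/imgP[x xi /mem_stageP[yFx _]]].
by case/imgP=> x' _ /mem_stageP[_ /(_ i x ltij xi)]; rewrite yFx.
Qed.

Hypothesis hallF : hall_partition F Ws.

Lemma blockP x : exists i, x \in tnth Ws i.
Proof.
have : x \in \bigcup_(i < m) tnth Ws i by rewrite (hall_cover hallF).
by case/bigcupP=> i _; exists i.
Qed.

Lemma block_inj i j x : x \in tnth Ws i -> x \in tnth Ws j -> i = j.
Proof.
move=> xi xj; apply/eqP/negP=> /negP neij.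
by have /pred0P/(_ x) := hall_disjoint hallF neij; rewrite /= xi xj.
Qed.

Lemma hall_mappingE i x :
  x \in tnth Ws i -> hall_mapping F Ws x = stage F Ws i x.
Proof.
move=> xi; rewrite /hall_mapping (big_pred1 i) // => j /=.
by apply/idP/eqP => [xj|->//]; apply: block_inj xj xi.
Qed.

Lemma layer_neq0 i : 0 < #|layer i|.
Proof.
have /set0Pn[x xi] := hall_nonempty hallF i.
have /set0Pn[y yx] := hall_values hallF xi.
by apply/card_gt0P; exists y; apply/imgP; exists x.
Qed.

Lemma leq_card_layer i : #|tnth Ws i| <= #|layer i|.
Proof.
apply: non_reducible_hall (subxx _); first exact: hall_non_reducible.
by move=> x; apply: hall_values.
Qed.

Lemma card_img_layers : #|img F [set: X]| = \sum_(i < m) #|layer i|.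
Proof.
have -> : img F [set: X] = \bigcup_i layer i.
  apply/setP=> y; apply/imgP/bigcupP => [[x _ yFx]|[i _]].
    have [i xi] := blockP x; have [j _ yj] := layer_of xi yFx.
    by exists j.
  by case/imgP=> x _ /mem_stageP[yFx _]; exists x.
rewrite -sum1_card partition_disjoint_bigcup; last exact: layer_disjoint.
by apply: eq_bigr => i _; rewrite sum1_card.
Qed.

(** A one-valued stage makes each point of its block critical, so non-reducibility shrinks the block
    to one point, and every layer has exactly one value. *)
Lemma hall_mapping_singleton_card :
  (forall x, is_singleton (hall_mapping F Ws x)) -> m = #|img F [set: X]|.
Proof.
move=> single; rewrite card_img_layers -[LHS]card_ord -sum1_card.
apply: eq_bigr => i _; have /set0Pn[x xi] := hall_nonempty hallF i.
have [y] := single x; rewrite (hall_mappingE xi) => Gx.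
have /andP[_ /forallP/(_ [set x])] := hall_non_reducible hallF i.
rewrite /critical img1 Gx !cards1 eqxx andbT -card_gt0 cards1 implybF.
rewrite properEneq sub1set xi andbT negbK => /eqP Wx.
by rewrite /layer -Wx img1 Gx cards1.
Qed.

Lemma hall_card_unique_selection :
  m = #|img F [set: X]| -> exists! s : {ffun X -> Y}, alldiff_selection F s.
Proof.
move=> cardF.
have layer1 i : #|layer i| = 1.
  (* The [m] terms are at least 1 and add up to [m]: the equality case of the summed inequality
     makes each of them 1. *)
  have /leqif_sum :
      forall i : 'I_m, true -> 1 <= #|layer i| ?= iff (1 == #|layer i|).
    by move=> k _; apply/leqif_eq/layer_neq0.
  case=> _; rewrite sum1_card card_ord -card_img_layers -cardF eqxx.
  by move/esym/forallP/(_ i) => /= /eqP.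
have block1 i x x' : x \in tnth Ws i -> x' \in tnth Ws i -> x = x'.
  by move=> xi x'i; apply: (card_le1_eqP (A := tnth Ws i) _) => //;
    rewrite -(layer1 i) leq_card_layer.
have layer_eq i y y' : y \in layer i -> y' \in layer i -> y = y'.
  by move=> yi y'i; apply: (card_le1_eqP (A := layer i) _) => //;
    rewrite layer1.
have layer_inj i j y : y \in layer i -> y \in layer j -> i = j.
  move=> yi yj; apply/eqP/negP=> /negP /layer_disjoint /pred0P/(_ y).
  by rewrite /= yi yj.
have value x : exists y, y \in hall_mapping F Ws x.
  have [i xi] := blockP x; rewrite (hall_mappingE xi).
  by apply/set0Pn; apply: hall_values.
pose s := [ffun x => xchoose (value x)].
have s_stage i x : x \in tnth Ws i -> s x \in stage F Ws i x.
  by move=> xi; rewrite ffunE -(hall_mappingE xi); apply: xchooseP.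
have s_layer i x : x \in tnth Ws i -> s x \in layer i.
  by move=> xi; apply/imgP; exists x; last exact: s_stage.
exists s; split.
  apply/alldiff_selectionP; split=> [x|x x' eqs].
    by have [i /s_stage/mem_stageP[]] := blockP x.
  have [[i xi] [j x'j]] := (blockP x, blockP x').
  have eqij : i = j.
    by apply: layer_inj (s_layer _ _ xi) _; rewrite eqs; apply: s_layer.
  by apply: block1 xi _; rewrite eqij.
move=> t /alldiff_selectionP[tF t_inj]; apply/ffunP=> x.
have [i xi] := blockP x.
(* Strong induction on the block index: a value [t x] in an earlier layer [j] is already taken by
   [t] on block [j], where [t] agrees with [s], against injectivity. *)
have [n ltin] := ubnP (i : nat); elim: n => // n IHn in i ltin x xi *.
have [j] := layer_of xi (tF x).
rewrite leq_eqVlt => /orP[/eqP/val_inj-> txi|ltji txj].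
  exact: layer_eq (s_layer _ _ xi) txi.
have /set0Pn[z zj] := hall_nonempty hallF j.
have eqz := IHn j (leq_trans ltji ltin) z zj.
have tzx : t z = t x by apply: layer_eq txj; rewrite -eqz s_layer.
by move: zj ltji; rewrite (t_inj _ _ tzx) => /(block_inj xi)->; rewrite ltnn.
Qed.

End HallPartitions.

(** * From a unique selection to a Hall partition into singletons *)

Lemma mem_take_tnth (T : eqType) n (l : n.-tuple T) (i : nat) (j : 'I_n) :
  uniq l -> (tnth l j \in take i l) = (j < i).
Proof.
move=> l_uniq; rewrite in_take ?mem_tnth // (tnth_nth (tnth l j)).
by rewrite index_uniq ?size_tuple.
Qed.

Section UniqueSelection.

Variables (X Y : finType) (F : X -> {set Y}) (s : {ffun X -> Y}).
Hypothesis sF : alldiff_selection F s.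
Hypothesis s_unique : forall t, alldiff_selection F t -> s = t.

(** Changing [s] at [x] alone to a value outside its range would keep it injective and give a second
    selection. *)
Lemma unique_selection_range x y : y \in F x -> exists x', y = s x'.
Proof.
have [s_in s_inj] := alldiff_selectionP _ _ sF.
move=> yFx; suff /codomP[x' ->] : y \in codom s by exists x'.
apply/negPn/negP=> yNs.
pose t := [ffun z => if z == x then y else s z].
suff /s_unique/ffunP/(_ x) : alldiff_selection F t.
  by rewrite ffunE eqxx => sxy; rewrite -sxy codom_f in yNs.
apply/alldiff_selectionP; split=> [z|z z']; rewrite !ffunE.
  by case: eqP => [->|].
have neys w : y = s w -> False by move=> ys; rewrite ys codom_f in yNs.
case: eqP => [->|_]; case: eqP => [->|_] //; last exact: s_inj.
  by move/neys.
by move/esym/neys.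
Qed.

Lemma unique_selection_next (W : {set X}) : W != setT ->
  exists2 x, x \notin W & F x \subset s @: (x |: W).
Proof.
have [s_in s_inj] := alldiff_selectionP _ _ sF.
move=> WnT; apply/exists_inP; apply: contraT.
rewrite negb_exists_in => /forall_inP none.
(* The implication leaves the successor arbitrary on [W], so that [f] can be a total function. *)
have succ x : exists x', x \notin W ->
    [&& x' \notin W, x' != x & s x' \in F x].
  have [xW|xNW] := boolP (x \in W); first by exists x.
  have /subsetPn[y yFx yN] := none x xNW.
  have [x' ys] := unique_selection_range yFx; exists x' => _.
  rewrite -ys yFx andbT -negb_or orbC.
  by apply: contra yN => x'W; rewrite ys imset_f // !inE.
have [f fP] := fin_all_exists succ.
pose stable (U : {set X}) := (U != set0) && (f @: U \subset U).
have stableC : stable (~: W).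
  apply/andP; split; first by rewrite -setCT (inj_eq (@setC_inj X)).
  apply/subsetP=> _ /imsetP[x xW ->]; rewrite !inE in xW *.
  by have /andP[] := fP x xW.
(* The image of a stable set is stable, so [f] maps a minimal one onto itself and permutes it. *)
have [U /minsetP[/andP[U_neq0 fUU] minU] sUW] := minset_exists stableC.
have fU : f @: U = U.
  apply: minU => //; apply/andP; split; last exact: imsetS.
  by have /set0Pn[x xU] := U_neq0; apply/set0Pn; exists (f x); apply: imset_f.
have f_inj : {in U &, injective f} by apply/imset_injP; rewrite fU.
have inU x : x \in U -> f x \in U by move=> xU; rewrite -fU imset_f.
have fPU x : x \in U -> [&& f x \notin W, f x != x & s (f x) \in F x].
  by move/(subsetP sUW); rewrite inE => /fP.
(* Each point of [U] takes over the value of its successor, which differs from its own because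
   [f x != x]. *)
pose t := [ffun x => s (if x \in U then f x else x)].
have /s_unique/ffunP eq_st : alldiff_selection F t.
  apply/alldiff_selectionP; split=> [x|x x']; rewrite !ffunE.
    by case: ifP => // /fPU/and3P[].
  move/s_inj; case: ifP => xU; case: ifP => x'U //; first exact: f_inj.
    by move=> eqx'; rewrite -eqx' inU in x'U.
  by move=> eqx; rewrite eqx inU in xU.
have /set0Pn[x xU] := U_neq0.
have /and3P[_ /eqP fx_neq _] := fPU x xU.
by have := eq_st x; rewrite ffunE xU => /s_inj/esym.
Qed.

(** Greedy construction: the previous lemma, applied to the points listed so far, supplies the next
    one. The bound [i.+1] lets a point use its own value. *)
Lemma unique_selection_enum n : n <= #|X| ->
  exists l : n.-tuple X, uniq l /\
    forall i : 'I_n, F (tnth l i) \subset [set s x | x in take i.+1 l].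
Proof.
elim: n => [_|n IHn ltnX]; first by exists [tuple]; split=> // -[].
have [l [l_uniq lF]] := IHn (ltnW ltnX).
have [|x xl xF] := @unique_selection_next [set:: l].
  apply: contraTneq ltnX => lT; rewrite -leqNgt -cardsT -lT cardsE.
  by rewrite (leq_trans (card_size _)) ?size_tuple.
rewrite inE in xl.
exists [tuple of rcons l x]; split; first by rewrite rcons_uniq xl.
move=> i; rewrite (tnth_nth x) /= nth_rcons size_tuple.
have [ltin|] := ltnP i n.
  have := lF (Ordinal ltin); rewrite (tnth_nth x) /=.
  by rewrite -cats1 takel_cat // size_tuple.
rewrite leq_eqVlt ltnNge -ltnS ltn_ord orbF => /eqP <-.
rewrite eqxx take_oversize ?size_rcons ?size_tuple //.
apply: subset_trans xF _; apply: imsetS; apply/subsetP=> z.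
by rewrite !inE mem_rcons inE.
Qed.

Lemma unique_selection_hall : 0 < #|X| ->
  exists (m : nat) (Ws : m.-tuple {set X}),
    hall_partition F Ws /\ forall x : X, is_singleton (hall_mapping F Ws x).
Proof.
have [s_in s_inj] := alldiff_selectionP _ _ sF.
move=> X_gt0; have [l [l_uniq lF]] := unique_selection_enum (leqnn _).
pose Ws := [tuple [set tnth l i] | i < #|X|].
have WsE i : tnth Ws i = [set tnth l i] by rewrite tnth_mktuple.
have l_inj : injective (tnth l) by apply/tuple_uniqP.
have l_surj x : exists i, x = tnth l i.
  by apply/codomP; apply: inj_card_onto l_inj _ _; rewrite card_ord.
(* Values of earlier points are removed; the point's own value survives, since its membership in
   [F (tnth l j)] forces [i <= j] by triangularity. *)
have stageE i : stage F Ws i (tnth l i) = [set s (tnth l i)].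
  apply/setP=> y; rewrite in_set1; apply/mem_stageP/eqP => [[yF yN]|->].
    have /imsetP[x xl ys] := subsetP (lF i) y yF.
    have [j xj] := l_surj x; rewrite {x}xj in xl ys.
    move: xl; rewrite mem_take_tnth // ltnS leq_eqVlt.
    move=> /orP[/eqP/val_inj<-//|ltji].
    have := yN j (tnth l j) ltji.
    by rewrite WsE set11 ys s_in => /(_ isT).
  split=> // j x ltji; rewrite WsE in_set1 => /eqP->.
  apply: contraTN ltji => sF'; rewrite -leqNgt.
  have /imsetP[x' x'l /s_inj eqx'] := subsetP (lF j) _ sF'.
  by rewrite -eqx' mem_take_tnth in x'l.
have hallF : hall_partition F Ws.
  split=> //.
  - by move=> i; rewrite WsE -card_gt0 cards1.
  - move=> i j neij; rewrite !WsE disjoints1 in_set1.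
    by apply: contra neij => /eqP/l_inj->.
  - apply/setP=> x; rewrite in_setT; apply/bigcupP.
    by have [i ->] := l_surj x; exists i => //; rewrite WsE set11.
  - move=> i x; rewrite WsE in_set1 => /eqP->.
    by rewrite stageE -card_gt0 cards1.
  (* The only proper subset of a singleton is empty, hence not critical. *)
  - move=> i; rewrite /non_reducible WsE -card_gt0 cards1; apply/forallP=> U.
    apply/implyP=> /proper_card; rewrite cards1 ltnS leqn0 cards_eq0 => /eqP->.
    by rewrite /critical eqxx.
  - by move=> i _; rewrite /critical WsE img1 stageE !cards1 -card_gt0 cards1.
exists #|X|, Ws; split=> // x; have [i ->] := l_surj x; exists (s (tnth l i)).
by rewrite (hall_mappingE hallF (i := i)) // WsE set11.
Qed.

End UniqueSelection.

(** * The kernel and the cycle of implications *)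

Lemma mem_alldiff_kernel (X Y : finType) (F : X -> {set Y}) x y :
  reflect (exists2 s : {ffun X -> Y}, alldiff_selection F s & s x = y)
          (y \in alldiff_kernel F x).
Proof.
rewrite inE; apply: (iffP andP) => [[_ /existsP[s /andP[sF /eqP]]]|[s sF sxy]].
  by exists s.
split; first by have [/(_ x)] := alldiff_selectionP _ _ sF; rewrite sxy.
by apply/existsP; exists s; rewrite sF sxy eqxx.
Qed.

Theorem theorem7p1 (X Y : finType) (hX : 0 < #|X|) (hY : 0 < #|Y|)
    (F : X -> {set Y}) :
  [<-> exists! s : {ffun X -> Y}, alldiff_selection F s;
       forall x : X, is_singleton (alldiff_kernel F x);
       exists (m : nat) (Ws : m.-tuple {set X}),
         hall_partition F Ws /\ forall x : X, is_singleton (hall_mapping F Ws x);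
       exists (m : nat) (Ws : m.-tuple {set X}),
         hall_partition F Ws /\ m = #|img F [set: X]| ].
Proof.
tfae.
- move=> [s [sF s_unique]] x; exists (s x); apply/setP=> y; rewrite in_set1.
  apply/mem_alldiff_kernel/eqP => [[t /s_unique<-]//|->]; by exists s.
(* The kernel at one point is nonempty, which yields a selection to start from. *)
- move=> single; have /card_gt0P[x0 _] := hX.
  have [y0 ker0] := single x0.
  have /mem_alldiff_kernel[s sF _] : y0 \in alldiff_kernel F x0.
    by rewrite ker0 set11.
  apply: (unique_selection_hall sF _ hX) => t tF; apply/ffunP=> x.
  have [y kerx] := single x.
  (* Every alldifferent selection takes its values in the kernel, so singleton kernels leave only
     one. *)
  have ker_eq u : alldiff_selection F u -> u x = y.
    move=> uF; apply/set1P; rewrite -kerx.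
    by apply/mem_alldiff_kernel; exists u.
  by rewrite !ker_eq.
- move=> [m [Ws [hallF single]]]; exists m, Ws; split=> //.
  exact: hall_mapping_singleton_card hallF single.
- move=> [m [Ws [hallF cardF]]].
  exact: (hall_card_unique_selection hallF cardF).
Qed.
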